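(* Let $A\subseteq\mathbb{R}^n$ and $B\subseteq\mathbb{R}^m$ be any sets, $(x,y)\in A\times B$ and $(d,w)\in\mathbb{R}^n\times\mathbb{R}^m$. Then $$N_{A\times B}((x,y);(d,w))\subseteq N_A(x;d)\times N_B(y;w).$$ Moreover, if either $A$ is regular at $x$ in direction $d$ or $B$ is regular at $y$ in direction $w$, then $$N_{A\times B}((x,y);(d,w))= N_A(x;d)\times N_B(y;w).$$ If $A$ is regular at $x$ in direction $d$ and $B$ is regular at $y$ in direction $w$, then $A\times B$ is regular at $(x,y)$ in direction $(d,w)$.
   Context: For $C\subseteq\mathbb{R}^n$: the regular (Fréchet) normal cone is $\widehat N_C(z)=\{v:\langle v,z'-z\rangle\le o(\|z'-z\|)\ \forall z'\in C\}$ for $z\in C$, and $\widehat N_C(z)=\emptyset$ for $z\notin C$. For $z\in C$ and $d\in\mathbb{R}^n$, the directional limiting normal cone is $N_C(z;d)=\{v:\exists t_k\downarrow0,\ d_k\to d,\ v_k\to v\text{ with }v_k\in\widehat N_C(z+t_kd_k)\ \forall k\}$, and the inner directional limiting normal cone is $N^i_C(z;d)=\{v:\forall t_k\downarrow0\ \exists d_k\to d,\ v_k\to v\text{ with }v_k\in\widehat N_C(z+t_kd_k)\ \forall k\}$ ($t_k\downarrow0$ means $t_k>0$, $t_k\to0$). $C$ is regular at $z$ in direction $d$ if $N_C(z;d)=N_C^i(z;d)$. *)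

(* Defs.v *)
From HB Require Import structures.
From mathcomp Require Import all_boot all_order all_algebra.
From mathcomp Require Import all_classical all_reals all_analysis.
Import Order.TTheory GRing.Theory Num.Theory.
Import numFieldNormedType.Exports.

Set Implicit Arguments.
Unset Strict Implicit.
Unset Printing Implicit Defensive.

Local Open Scope classical_set_scope.
Local Open Scope ring_scope.

Section DirectionalNormalCones.
Variables (R : realType) (n : nat).
Implicit Types (C : set 'rV[R]_n) (z d v : 'rV[R]_n).

Definition dotv (u v : 'rV[R]_n) : R := \sum_(i < n) u 0 i * v 0 i.

(* The library norm `|u| on 'rV[R]_n is the sup norm. *)
Definition eucl_norm (u : 'rV[R]_n) : R := Num.sqrt (dotv u u).

(* One-sided little-o: for every e > 0, <v, z' - z> <= e ||z' - z|| for all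
   z' in C close enough to z.  The conjunct C z makes the cone empty when z
   is not in C. *)
Definition frechet_normal_cone C z : set 'rV[R]_n :=
  [set v | C z /\
    forall e : R, 0 < e ->
      \forall z' \near z, C z' -> dotv v (z' - z) <= e * eucl_norm (z' - z)].

Definition cvg_down0 (t : nat -> R) : Prop :=
  (forall k, 0 < t k) /\ t @ \oo --> (0 : R).

Definition dir_normal_cone C z d : set 'rV[R]_n :=
  [set v | exists (t : nat -> R) (d_ v_ : nat -> 'rV[R]_n),
    [/\ cvg_down0 t, d_ @ \oo --> d, v_ @ \oo --> v &
        forall k, frechet_normal_cone C (z + t k *: d_ k) (v_ k)]].

Definition inner_dir_normal_cone C z d : set 'rV[R]_n :=
  [set v | forall t : nat -> R, cvg_down0 t ->
    exists d_ v_ : nat -> 'rV[R]_n,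
    [/\ d_ @ \oo --> d, v_ @ \oo --> v &
        forall k, frechet_normal_cone C (z + t k *: d_ k) (v_ k)]].

Definition dir_regular C z d : Prop :=
  dir_normal_cone C z d = inner_dir_normal_cone C z d.

End DirectionalNormalCones.

(* The Cartesian product, with R^n x R^m identified with R^(n + m) by
   concatenation of row vectors. *)
Definition prod_rV (R : realType) (n m : nat)
    (A : set 'rV[R]_n) (B : set 'rV[R]_m) : set 'rV[R]_(n + m) :=
  [set row_mx a b | a in A & b in B].

(* Main.v *)
Require Import Defs.
From HB Require Import structures.
From mathcomp Require Import all_boot all_order all_algebra.
From mathcomp Require Import all_classical all_reals all_analysis.
Import Order.TTheory GRing.Theory Num.Theory.
Import numFieldNormedType.Exports.
Local Open Scope classical_set_scope.
Local Open Scope ring_scope.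

(** A Fréchet normal to [A × B] at [z] is exactly a pair of Fréchet normals to
    [A] and [B] at the two components of [z], because the Euclidean norm of a
    pair dominates the norms of its components and agrees with them on pairs
    having a zero component. The inclusion follows by projecting sequences. For
    the converse the two factors need a common step sequence [t_k]: the inner
    cone of the regular factor accepts the one provided by the other factor. *)

(** Balls of matrices are defined entry by entry, so the ball around a concatenation is the product
    of the balls of the same radius around its blocks. *)
Lemma cvg_row_mx (R : realType) (p n m : nat) (T : Type) (F : set_system T)
    {FF : Filter F} (f : T -> 'M[R]_(p, n)) (g : T -> 'M[R]_(p, m))
    (a : 'M[R]_(p, n)) (b : 'M[R]_(p, m)) :
  f @ F --> a -> g @ F --> b ->
  (fun t => row_mx (f t) (g t)) @ F --> row_mx a b.
Proof.
move=> /cvg_ballP fa /cvg_ballP gb; apply/cvg_ballP => e e0.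
near=> t.
have : ball a e (f t) by near: t; exact: fa.
have : ball b e (g t) by near: t; exact: gb.
move=> [_ bg] [_ af]; split => // i j; case: (split_ordP j) => k ->.
  by rewrite !row_mxEl; exact: af.
by rewrite !row_mxEr; exact: bg.
Unshelve. all: by end_near. Qed.

Lemma dotv_row_mx (R : realType) (n m : nat) (a u : 'rV[R]_n)
    (b v : 'rV[R]_m) :
  dotv (row_mx a b) (row_mx u v) = dotv a u + dotv b v.
Proof.
rewrite /dotv big_split_ord /=.
by congr +%R; apply: eq_bigr => i _; rewrite ?row_mxEl ?row_mxEr.
Qed.

Lemma dotv_ge0 (R : realType) (n : nat) (u : 'rV[R]_n) : 0 <= dotv u u.
Proof. by apply: sumr_ge0 => i _; rewrite -expr2 sqr_ge0. Qed.

Lemma dotvr0 (R : realType) (n : nat) (u : 'rV[R]_n) : dotv u 0 = 0.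
Proof. by rewrite /dotv big1 // => i _; rewrite mxE mulr0. Qed.

Lemma eucl_norm_lsubmx_le (R : realType) (n m : nat) (u : 'rV[R]_(n + m)) :
  eucl_norm (lsubmx u) <= eucl_norm u.
Proof.
(* Only the occurrences of [u] on the right are split into blocks; its square norm then exceeds that
   of the left block by a nonnegative term. *)
rewrite /eucl_norm -{3 4}(hsubmxK u) dotv_row_mx.
by rewrite ler_wsqrtr // lerDl dotv_ge0.
Qed.

Lemma eucl_norm_rsubmx_le (R : realType) (n m : nat) (u : 'rV[R]_(n + m)) :
  eucl_norm (rsubmx u) <= eucl_norm u.
Proof.
rewrite /eucl_norm -{3 4}(hsubmxK u) dotv_row_mx.
by rewrite ler_wsqrtr // lerDr dotv_ge0.
Qed.

Lemma eucl_norm_row_mx0 (R : realType) (n m : nat) (u : 'rV[R]_n) :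
  eucl_norm (row_mx u (0 : 'rV[R]_m)) = eucl_norm u.
Proof. by rewrite /eucl_norm dotv_row_mx dotvr0 addr0. Qed.

Lemma eucl_norm_row_0mx (R : realType) (n m : nat) (u : 'rV[R]_m) :
  eucl_norm (row_mx (0 : 'rV[R]_n) u) = eucl_norm u.
Proof. by rewrite /eucl_norm dotv_row_mx dotvr0 add0r. Qed.

Lemma prod_rVE (R : realType) (n m : nat) (A : set 'rV[R]_n)
    (B : set 'rV[R]_m) (z : 'rV[R]_(n + m)) :
  prod_rV A B z <-> A (lsubmx z) /\ B (rsubmx z).
Proof.
split=> [[a Aa [b Bb <-]]|[Aa Bb]]; first by rewrite row_mxKl row_mxKr.
by exists (lsubmx z) => //; exists (rsubmx z); rewrite ?hsubmxK.
Qed.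

Lemma frechet_normal_cone_prod (R : realType) (n m : nat) (A : set 'rV[R]_n)
    (B : set 'rV[R]_m) (a u : 'rV[R]_n) (b v : 'rV[R]_m) :
  frechet_normal_cone (prod_rV A B) (row_mx a b) (row_mx u v) <->
  frechet_normal_cone A a u /\ frechet_normal_cone B b v.
Proof.
split=> [[/prod_rVE[]]|[[Aa Nu] [Bb Nv]]].
  rewrite row_mxKl row_mxKr => Aa Bb N; split; split=> // e e0.
    (* Freezing the second component at [b], a point of [B], pulls the neighbourhood of the pair
       back to a neighbourhood of [a]; the increment then has zero second block, so the inequality
       for the pair reduces to the one for [A]. *)
    have cl : row_mx a' b @[a' --> a] --> row_mx a b.
      apply: (@cvg_row_mx R 1 n m _ (nbhs a) _ id (fun=> b)) => //.
      exact: cvg_cst.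
    have := cl _ (N _ e0); apply: (@filterS _ _ (nbhs_filter a)) => a' /= Na' Aa'.
    have /Na' : prod_rV A B (row_mx a' b) by exists a' => //; exists b.
    by rewrite opp_row_mx add_row_mx subrr dotv_row_mx dotvr0 addr0
      eucl_norm_row_mx0.
  have cr : row_mx a b' @[b' --> b] --> row_mx a b.
    apply: (@cvg_row_mx R 1 n m _ (nbhs b) _ (fun=> a) id) => //.
    exact: cvg_cst.
  have := cr _ (N _ e0); apply: (@filterS _ _ (nbhs_filter b)) => b' /= Nb' Bb'.
  have /Nb' : prod_rV A B (row_mx a b') by exists a => //; exists b'.
  by rewrite opp_row_mx add_row_mx subrr dotv_row_mx dotvr0 add0r
    eucl_norm_row_0mx.
split; first by apply/prod_rVE; rewrite row_mxKl row_mxKr.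
(* Each factor contributes at most [e / 2] times the norm of its own block of the increment, hence
   at most [e / 2] times the norm of the whole increment. *)
move=> e e0; have e20 : 0 < e / 2 by rewrite divr_gt0.
have cl : lsubmx z @[z --> row_mx a b] --> a.
  by rewrite -[X in _ --> X](row_mxKl a b); exact: continuous_lsubmx.
have cr : rsubmx z @[z --> row_mx a b] --> b.
  by rewrite -[X in _ --> X](row_mxKr a b); exact: continuous_rsubmx.
have NA := cl _ (Nu _ e20); have NB := cr _ (Nv _ e20).
apply: (@filterS2 _ _ (nbhs_filter (row_mx a b))) NA NB => z /= NA NB /prod_rVE[/NA {}NA /NB {}NB].
set q := z - row_mx a b.
have la : lsubmx z - a = lsubmx q by rewrite linearB /= row_mxKl.
have rb : rsubmx z - b = rsubmx q by rewrite linearB /= row_mxKr.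
rewrite -[q in leLHS](hsubmxK q) dotv_row_mx (splitr e) mulrDl.
rewrite -la -rb; apply: lerD.
  by apply: le_trans NA _; rewrite la ler_pM2l // eucl_norm_lsubmx_le.
by apply: le_trans NB _; rewrite rb ler_pM2l // eucl_norm_rsubmx_le.
Qed.

Lemma frechet_normal_cone_prod_step (R : realType) (n m : nat)
    (A : set 'rV[R]_n) (B : set 'rV[R]_m) (x d u : 'rV[R]_n)
    (y w v : 'rV[R]_m) (t : R) :
  frechet_normal_cone (prod_rV A B) (row_mx x y + t *: row_mx d w)
    (row_mx u v) <->
  frechet_normal_cone A (x + t *: d) u /\ frechet_normal_cone B (y + t *: w) v.
Proof. by rewrite scale_row_mx add_row_mx; exact: frechet_normal_cone_prod. Qed.

(** A universal condition on step sequences yields an existential one once some admissible sequence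
    exists; [harmonic] is such a sequence. *)
Lemma inner_dir_normal_cone_sub (R : realType) (n : nat) (C : set 'rV[R]_n)
    (z d : 'rV[R]_n) :
  inner_dir_normal_cone C z d `<=` dir_normal_cone C z d.
Proof.
move=> v Nv; have t0 : cvg_down0 (@harmonic R).
  by split; [exact: harmonic_gt0 | exact: cvg_harmonic].
by have [d_ [v_ [dd vv N]]] := Nv _ t0; exists harmonic, d_, v_.
Qed.

(** Both factors inherit the step sequence of the product; the block projections are continuous, so
    directions and normals still converge. *)
Lemma dir_normal_cone_prod_sub (R : realType) (n m : nat) (A : set 'rV[R]_n)
    (B : set 'rV[R]_m) (x d : 'rV[R]_n) (y w : 'rV[R]_m) :
  dir_normal_cone (prod_rV A B) (row_mx x y) (row_mx d w) `<=`
    prod_rV (dir_normal_cone A x d) (dir_normal_cone B y w).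
Proof.
move=> v [t [d_ [v_ [t0 dd vv N]]]].
have N' k : frechet_normal_cone A (x + t k *: lsubmx (d_ k)) (lsubmx (v_ k)) /\
    frechet_normal_cone B (y + t k *: rsubmx (d_ k)) (rsubmx (v_ k)).
  by apply/frechet_normal_cone_prod_step; rewrite !hsubmxK.
apply/prod_rVE; split.
  exists t, (lsubmx \o d_), (lsubmx \o v_); split=> // [||k].
  - rewrite -[d](row_mxKl d w).
    exact: (cvg_comp _ _ dd (@continuous_lsubmx R 1 n m _)).
  - exact: (cvg_comp _ _ vv (@continuous_lsubmx R 1 n m _)).
  - by have [] := N' k.
exists t, (rsubmx \o d_), (rsubmx \o v_); split=> // [||k].
- rewrite -[w](row_mxKr d w).
  exact: (cvg_comp _ _ dd (@continuous_rsubmx R 1 n m _)).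
- exact: (cvg_comp _ _ vv (@continuous_rsubmx R 1 n m _)).
- by have [] := N' k.
Qed.

(** Any prescribed step sequence is accepted by both factors at once, so the two answers can be
    concatenated. *)
Lemma prod_inner_dir_normal_cone_sub (R : realType) (n m : nat)
    (A : set 'rV[R]_n) (B : set 'rV[R]_m) (x d : 'rV[R]_n) (y w : 'rV[R]_m) :
  prod_rV (inner_dir_normal_cone A x d) (inner_dir_normal_cone B y w) `<=`
    inner_dir_normal_cone (prod_rV A B) (row_mx x y) (row_mx d w).
Proof.
move=> _ [u Nu [v Nv <-]] t t0.
have [d_ [u_ [dd uu NA]]] := Nu _ t0; have [w_ [v_ [ww vv NB]]] := Nv _ t0.
exists (fun k => row_mx (d_ k) (w_ k)), (fun k => row_mx (u_ k) (v_ k)).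
split=> [||k]; [exact: cvg_row_mx | exact: cvg_row_mx |].
by apply/frechet_normal_cone_prod_step.
Qed.

(** The step sequence comes from the normal to [B], and the inner cone of [A] adapts to it. *)
Lemma prod_inner_dir_normal_cone_subl (R : realType) (n m : nat)
    (A : set 'rV[R]_n) (B : set 'rV[R]_m) (x d : 'rV[R]_n) (y w : 'rV[R]_m) :
  prod_rV (inner_dir_normal_cone A x d) (dir_normal_cone B y w) `<=`
    dir_normal_cone (prod_rV A B) (row_mx x y) (row_mx d w).
Proof.
move=> _ [u Nu [v [t [w_ [v_ [t0 ww vv NB]]]] <-]].
have [d_ [u_ [dd uu NA]]] := Nu _ t0.
exists t, (fun k => row_mx (d_ k) (w_ k)), (fun k => row_mx (u_ k) (v_ k)).
split=> // [||k]; [exact: cvg_row_mx | exact: cvg_row_mx |].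
by apply/frechet_normal_cone_prod_step.
Qed.

Lemma prod_inner_dir_normal_cone_subr (R : realType) (n m : nat)
    (A : set 'rV[R]_n) (B : set 'rV[R]_m) (x d : 'rV[R]_n) (y w : 'rV[R]_m) :
  prod_rV (dir_normal_cone A x d) (inner_dir_normal_cone B y w) `<=`
    dir_normal_cone (prod_rV A B) (row_mx x y) (row_mx d w).
Proof.
move=> _ [u [t [d_ [u_ [t0 dd uu NA]]]] [v Nv <-]].
have [w_ [v_ [ww vv NB]]] := Nv _ t0.
exists t, (fun k => row_mx (d_ k) (w_ k)), (fun k => row_mx (u_ k) (v_ k)).
split=> // [||k]; [exact: cvg_row_mx | exact: cvg_row_mx |].
by apply/frechet_normal_cone_prod_step.
Qed.

Theorem proposition3p2 (R : realType) (n m : nat)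
    (A : set 'rV[R]_n) (B : set 'rV[R]_m)
    (x : 'rV[R]_n) (y : 'rV[R]_m) (hx : A x) (hy : B y)
    (d : 'rV[R]_n) (w : 'rV[R]_m) :
  [/\ dir_normal_cone (prod_rV A B) (row_mx x y) (row_mx d w) `<=`
        prod_rV (dir_normal_cone A x d) (dir_normal_cone B y w),
      (dir_regular A x d \/ dir_regular B y w) ->
        dir_normal_cone (prod_rV A B) (row_mx x y) (row_mx d w) =
        prod_rV (dir_normal_cone A x d) (dir_normal_cone B y w) &
      (dir_regular A x d /\ dir_regular B y w) ->
        dir_regular (prod_rV A B) (row_mx x y) (row_mx d w)].
Proof.
split; first exact: dir_normal_cone_prod_sub.
  move=> reg; apply/seteqP; split; first exact: dir_normal_cone_prod_sub.
  (* Regularity rewrites the cone of the regular factor as its inner cone, leaving the other factor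
     free to choose the steps. *)
  case: reg => ->; first exact: prod_inner_dir_normal_cone_subl.
  exact: prod_inner_dir_normal_cone_subr.
move=> [regA regB]; apply/seteqP; split; last exact: inner_dir_normal_cone_sub.
(* The normals to the product lie in the product of the limiting cones, which regularity turns into
   the product of the inner cones. *)
apply: subset_trans (@dir_normal_cone_prod_sub _ _ _ _ _ _ _ _ _) _.
by rewrite regA regB; exact: prod_inner_dir_normal_cone_sub.
Qed.
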